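(* Let $r,q,n$ be positive integers with $q\mid r$ and $\gcd(q,n)\le2$, and let $G=G(r,q,n)$. Then $s(G)\ge\Gamma_e(G)$, and $s(G)=\Gamma_e(G)$ if and only if $G$ is abelian.
   Context: $G(r,1,n)=\{(z_1,\dots,z_n;\sigma):z_i\in\mathbb{Z}_r,\sigma\in S_n\}$ with product $(z;\sigma)(z';\sigma')=(z_1+z'_{\sigma^{-1}(1)},\dots,z_n+z'_{\sigma^{-1}(n)};\sigma\sigma')$, and for $q\mid r$, $G(r,q,n)=\{(z_1,\dots,z_n;\sigma)\in G(r,1,n):\sum_i z_i\equiv0\pmod q\}$. For a finite group $G$, $s(G)$ is the sum of all entries of its complex character table and $\Gamma_e(G)$ is the sum of the degrees of its irreducible complex characters. *)

(* Defs.v *)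
From mathcomp Require Import all_boot all_order all_algebra all_fingroup all_solvable all_field all_character.
Set Implicit Arguments. Unset Strict Implicit. Unset Printing Implicit Defensive.
Import GRing.Theory Num.Theory.
Local Open Scope ring_scope.

(* G(r,q,n) realized as a permutation group on Z_r x {0..n-1}:
   (z;sigma) acts by (a,i) |-> (a + z_{sigma i} mod r, sigma i).
   This is a faithful (anti-)representation; the image set is closed under
   product and inverse, hence a subgroup isomorphic to G(r,q,n). *)
Definition Grqn_set (r q n : nat) : {set {perm 'I_r * 'I_n}} :=
  [set p : {perm 'I_r * 'I_n} |
     [exists z : {ffun 'I_n -> 'I_r}, exists s : {perm 'I_n},
        ((\sum_(i < n) (z i : nat)) %% q == 0)%N &&
        [forall x : 'I_r * 'I_n,
           (((p x).1 : nat) == (x.1 + z (s x.2)) %% r)%N && ((p x).2 == s x.2)]]].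

(* The group G(r,q,n): the subgroup generated by (in fact equal to) Grqn_set. *)
Definition Grqn (r q n : nat) : {group {perm 'I_r * 'I_n}} := <<Grqn_set r q n>>%G.

Definition char_table_sum (gT : finGroupType) (G : {group gT}) : algC :=
  \sum_(i < Nirr G) \sum_(j < Nirr G) character_table G i j.

Definition Gamma_e (gT : finGroupType) (G : {group gT}) : algC :=
  \sum_(i < Nirr G) 'chi[G]_i 1%g.

(* Main.v *)
Require Import Defs.
From mathcomp Require Import all_boot all_order all_algebra all_fingroup all_solvable all_field all_character.
Import GRing.Theory Num.Theory.
Local Open Scope ring_scope.
Set Implicit Arguments. Unset Strict Implicit. Unset Printing Implicit Defensive.

(** View G(r,q,n) as a group of monomial matrices and let [sigma] be
    transposition, an anti-automorphism with [sigma x^-1 = conj x]. If every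
    irreducible representation [rho] carries a nondegenerate symmetric form for
    which [rho (sigma x)] is the adjoint of [rho x], then its Frobenius-Schur
    indicator twisted by complex conjugation is 1, and the sum of the column of
    [g] in the character table is a positive multiple of the number of [x] for
    which [x * conj x] is conjugate to [g]. So the column sums are nonnegative,
    and all but that of the identity vanish only if [conj x = x^-1] for every
    [x], which forces the group to be abelian.

    A form exchanging [rho x] and [rho (sigma x)] is shown to be symmetric by
    descent along the subgroups fixing more and more of the indices, down to
    the diagonal subgroup. If every element of [G] is [H]-conjugate to its
    transpose, each endomorphism commuting with [H] is self-adjoint, as an
    [H]-average of group elements; hence an [H]-equivariant projection onto a
    simple [H]-module is orthogonal, and the form restricts to a nonzero form
    there. The conjugating elements invert the abelian group generated by [g]
    and the scalar rotation; their color is corrected modulo [q] by scalars,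
    up to a parity obstruction when [gcd(q,n) = 2], which disappears by
    bipartitioning the cycles of [g]. *)

Definition antimorphic (gT : finGroupType) (sigma : gT -> gT) : Prop :=
  {morph sigma : x y / (x * y)%g >-> (y * x)%g}.

Section AntimorphismTheory.

Variables (gT : finGroupType) (sigma : gT -> gT).
Hypothesis sigmaM : antimorphic sigma.

Lemma antimorph1 : sigma 1%g = 1%g.
Proof. by apply: (mulgI (sigma 1%g)); rewrite -sigmaM !mulg1. Qed.

Lemma antimorphV x : sigma x^-1%g = (sigma x)^-1%g.
Proof.
by apply: (mulgI (sigma x)); rewrite -sigmaM mulVg mulgV antimorph1.
Qed.

Lemma antimorphJ x y : sigma (x ^ y)%g = (sigma x ^ (sigma y)^-1)%g.
Proof. by rewrite !conjgE invgK !sigmaM antimorphV mulgA. Qed.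

Lemma id_antimorphic_abelian (G : {group gT}) :
  {in G, sigma =1 id} -> abelian G.
Proof.
move=> sigma_id; apply/centsP=> x Gx y Gy.
by rewrite /commute -[LHS]sigma_id ?groupM // sigmaM !sigma_id.
Qed.

End AntimorphismTheory.

Section ConjugationSums.

Variables (F : fieldType) (gT : finGroupType) (G : {group gT}) (n : nat).
Variable rG : mx_representation F G n.

Definition conj_sum (A : {set gT}) (M : 'M_n) : 'M_n :=
  \sum_(h in A) rG h^-1%g *m M *m rG h.

Lemma conj_sum_comm (H : {group gT}) M :
    H \subset G -> {in H, forall h, comm_mx M (rG h)} ->
  conj_sum H M = #|H|%:R *: M.
Proof.
move=> /subsetP sHG cM; rewrite scaler_nat -sumr_const.
apply: eq_bigr => h Hh; have Gh := sHG h Hh.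
by rewrite -mulmxA cM // mulmxA -repr_mxM ?groupV // mulVg repr_mx1 mul1mx.
Qed.

Lemma conj_sum_linear_combination (A : {set gT}) (c : gT -> F) : A \subset G ->
  conj_sum A (\sum_(x in G) c x *: rG x)
    = \sum_(x in G) c x *: \sum_(h in A) rG (x ^ h)%g.
Proof.
move=> /subsetP sAG; rewrite /conj_sum.
under eq_bigr do rewrite mulmx_sumr mulmx_suml.
rewrite exchange_big; apply: eq_bigr => x Gx; rewrite scaler_sumr.
apply: eq_bigr => h Ah; have Gh := sAG h Ah.
by rewrite -scalemxAr -scalemxAl conjgE mulgA !repr_mxM ?groupM ?groupV.
Qed.

Lemma conj_sum_centgmx M : centgmx rG (conj_sum G M).
Proof.
apply/centgmxP=> x Gx; rewrite mulmx_suml mulmx_sumr.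
rewrite (reindex_inj (mulIg x^-1%g)) /=.
apply: eq_big => [h | h]; rewrite groupMr ?groupV // => Gh.
by rewrite invMg invgK !repr_mxM ?groupV // !mulmxA repr_mxKV.
Qed.

Lemma mxtrace_conj_sum M : \tr (conj_sum G M) = #|G|%:R * \tr M.
Proof.
rewrite /conj_sum linear_sum /= mulr_natl -sumr_const.
by apply: eq_bigr => h Gh; rewrite -mulmxA mxtrace_mulC repr_mxK.
Qed.

Hypothesis absG : mx_absolutely_irreducible rG.

Lemma conj_sum_abs_irr M : n%:R *: conj_sum G M = (#|G|%:R * \tr M)%:M.
Proof.
have /is_scalar_mxP[a aE] := mx_abs_irr_cent_scalar absG (conj_sum_centgmx M).
by rewrite -mxtrace_conj_sum aE mxtrace_scalar scale_scalar_mx mulr_natl.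
Qed.

Lemma repr_entry_orthogonality i j k l :
  n%:R * (\sum_(x in G) rG x i j * rG x^-1%g l k)
    = #|G|%:R * ((i == k) && (j == l))%:R.
Proof.
have /matrixP/(_ l j) := conj_sum_abs_irr (delta_mx k i).
have -> : \tr (delta_mx k i : 'M[F]_n) = (i == k)%:R.
  rewrite -(mul_delta_mx (0 : 'I_1)) mxtrace_mulC mul_delta_mx_cond.
  by rewrite trace_mx11 mulmxnE mxE.
rewrite !mxE summxE -mulrnAr -mulrnA mulnb [l == j]eq_sym => <-.
congr (_ * _); apply: eq_bigr => x _.
rewrite -(mul_delta_mx (0 : 'I_1)) mulmxA -mulmxA -rowE -colE mxE big_ord1 !mxE.
exact: mulrC.
Qed.

(* Schur orthogonality: the average over [G] of the tensor products of [rG x]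
   with [rG x^-1] is [1 / n] times the swap of the two factors. *)
Lemma sum_trmx_reprV_mulmx C :
  n%:R *: \sum_(x in G) (rG x^-1%g)^T *m C *m rG x = #|G|%:R *: C^T.
Proof.
apply/matrixP=> k j; rewrite !mxE summxE.
under eq_bigr => x _ do rewrite mxE.
transitivity (\sum_i \sum_l C l i
   * (n%:R * \sum_(x in G) rG x i j * rG x^-1%g l k)).
  rewrite exchange_big mulr_sumr; apply: eq_bigr => i _.
  under [RHS]eq_bigr do rewrite mulrCA mulr_sumr.
  rewrite -mulr_sumr exchange_big /=; congr (_ * _).
  apply: eq_bigr => x _; rewrite mxE mulr_suml; apply: eq_bigr => l _.
  by rewrite mxE mulrC mulrA mulrC.
under eq_bigr => i _.
  under eq_bigr do rewrite repr_entry_orthogonality; over.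
rewrite (bigD1 k) //= [X in _ + X]big1 => [|i /negPf ne_ik]; last first.
  by rewrite big1 // => l _; rewrite ne_ik !mulr0.
rewrite (bigD1 j) //= big1 => [|l /negPf ne_lj]; last first.
  by rewrite eq_sym ne_lj andbF !mulr0.
by rewrite !eqxx mulr1 !addr0 mulrC.
Qed.

End ConjugationSums.

Lemma irreducible_direct_summand (F : decFieldType) (gT : finGroupType)
    (G : {group gT}) n (rG : mx_representation F G n) :
    #|G|%:R != 0 :> F -> (0 < n)%N ->
  exists k (rU : mx_representation F G k) (P : 'M_(k, n)) (Q : 'M_(n, k)),
    [/\ mx_irreducible rU, P *m Q = 1%:M,
        {in G, forall x, P *m rG x = rU x *m P}
      & {in G, forall x, rG x *m Q = Q *m rU x}].
Proof.
rewrite natf_neq0_pchar => charG n_gt0.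
have nz1 : (1%:M : 'M[F]_n) != 0 by rewrite -mxrank_eq0 mxrank1 -lt0n.
have [U simU _] := dec_mxsimple_exists (mxmodule1 rG) nz1.
have [modU _ _] := simU.
have [W modW defUW /mxdirect_addsP dxUW] :=
  mx_Maschke_pchar rG charG modU (submx1 U).
exists (\rank U), (submod_repr modU), (val_submod 1%:M).
exists (in_submod U (proj_mx U W)); split.
- exact/submod_mx_irr.
- rewrite in_submodE mulmxA -in_submodE proj_mx_id ?val_submodK //.
  exact: val_submodP.
- by move=> x Gx; rewrite -(val_submodJ modU) // mul1mx -val_submodE.
have proj_sub : (proj_mx U W <= U)%MS.
  by rewrite -[proj_mx U W]mul1mx proj_mx_sub.
move=> x Gx; rewrite -in_submodJ // [in LHS]in_submodE mulmxA -in_submodE.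
have := proj_mx_hom dxUW modU modW; rewrite defUW => /hom_mxP/(_ x Gx).
by rewrite !mul1mx => ->.
Qed.

Section ContravariantForms.

Variables (F : fieldType) (gT : finGroupType) (sigma : gT -> gT).

(* The bilinear form of matrix [B] has [rG x] and [rG (sigma x)] as adjoint
   operators. *)
Definition contravariant_form (G : {group gT}) n
    (rG : mx_representation F G n) (B : 'M_n) : Prop :=
  {in G, forall x, rG x *m B = B *m (rG (sigma x))^T}.

Definition contravariant_forms_symmetric (G : {group gT}) : Prop :=
  forall n (rG : mx_representation F G n) (B : 'M_n),
  mx_irreducible rG -> contravariant_form rG B -> B^T = B.

Definition self_adjoint n (B M : 'M[F]_n) : Prop := M *m B = B *m M^T.

Lemma self_adjoint_sum n (B : 'M_n) I (r : seq I) (P : pred I)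
    (M : I -> 'M_n) :
    (forall i, P i -> self_adjoint B (M i)) ->
  self_adjoint B (\sum_(i <- r | P i) M i).
Proof.
move=> adjM; rewrite /self_adjoint mulmx_suml linear_sum mulmx_sumr.
exact: eq_bigr.
Qed.

Lemma self_adjointZ n (B M : 'M_n) a :
  self_adjoint B M -> self_adjoint B (a *: M).
Proof.
by rewrite /self_adjoint linearZ /= -scalemxAl -scalemxAr => ->.
Qed.

Section Representation.

Variables (G : {group gT}) (n : nat) (rG : mx_representation F G n).

Lemma contravariant_form_row_free B :
  mx_irreducible rG -> contravariant_form rG B -> B != 0 -> row_free B.
Proof.
move=> /mx_irrP[_ irrG] formB nzB.
rewrite -kermx_eq0; apply: contraR nzB => nzK.
have modK : mxmodule rG (kermx B).
  apply/mxmoduleP=> x Gx; apply/sub_kermxP.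
  by rewrite -mulmxA formB // mulmxA mulmx_ker mul0mx.
have := irrG _ modK nzK; rewrite -sub1mx => /sub_kermxP.
by rewrite mul1mx => ->.
Qed.

Lemma contravariant_formB B C :
    contravariant_form rG B -> contravariant_form rG C ->
  contravariant_form rG (B - C).
Proof. by move=> formB formC x Gx; rewrite mulmxBr mulmxBl formB ?formC. Qed.

Lemma contravariant_form_tr B :
    involutive sigma -> {in G, forall x, sigma x \in G} ->
  contravariant_form rG B -> contravariant_form rG B^T.
Proof.
move=> sigmaK sG formB x Gx; apply: trmx_inj.
by rewrite !trmx_mul !trmxK formB ?sG // sigmaK.
Qed.

Lemma contravariant_form_compression (H : {group gT}) k
    (rH : mx_representation F H k) (P : 'M_(k, n)) B :
    H \subset G -> {in H, forall h, sigma h \in H} ->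
    {in H, forall h, P *m rG h = rH h *m P} ->
  contravariant_form rG B -> contravariant_form rH (P *m B *m P^T).
Proof.
move=> /subsetP sHG sH PJ formB h Hh.
rewrite !mulmxA -PJ // -[P *m _ *m B]mulmxA formB ?sHG //.
by rewrite -!mulmxA -!trmx_mul -PJ ?sH.
Qed.

End Representation.

End ContravariantForms.

Lemma abelian_contravariant_forms_symmetric (F : fieldType)
    (gT : finGroupType) (sigma : gT -> gT) (G : {group gT}) :
    group_splitting_field F G -> abelian G ->
  contravariant_forms_symmetric F sigma G.
Proof.
move=> splitG abG n rG B irrG _.
move: B; rewrite (mx_irr_abelian_linear splitG irrG abG) => B.
by rewrite [B]mx11_scalar tr_scalar_mx.
Qed.

Section SubgroupReversal.

Variables (F : closedFieldType) (gT : finGroupType) (sigma : gT -> gT).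
Variables G H : {group gT}.
Hypotheses (sigmaM : antimorphic sigma) (sigmaK : involutive sigma).
Hypotheses (sHG : H \subset G) (sigmaH : {in H, forall h, sigma h \in H}).
Hypothesis sigma_conj :
  {in G, forall g, exists2 k, k \in H & sigma g = (g ^ k)%g}.
Hypotheses (nzH : #|H|%:R != 0 :> F) (nz2 : 2%:R != 0 :> F).

Lemma conjugate_reversal_stable : {in G, forall g, sigma g \in G}.
Proof.
move=> g Gg; have [k Hk ->] := sigma_conj Gg.
by rewrite groupJ // (subsetP sHG).
Qed.

Section Representation.

Variables (n : nat) (rG : mx_representation F G n) (B : 'M[F]_n).
Hypotheses (irrG : mx_irreducible rG) (formB : contravariant_form sigma rG B).

(* The reversal [sigma] permutes the [H]-conjugates of [x]. *)
Lemma conj_repr_sum_self_adjoint x :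
  x \in G -> self_adjoint B (\sum_(h in H) rG (x ^ h)%g).
Proof.
move=> Gx; rewrite /self_adjoint mulmx_suml.
rewrite (eq_bigr (fun h => B *m (rG (sigma (x ^ h)%g))^T)); last first.
  by move=> h Hh; rewrite formB // groupJ // (subsetP sHG).
rewrite -mulmx_sumr; congr (_ *m _); rewrite linear_sum /=.
have [k Hk sigma_x] := sigma_conj Gx.
pose f h := (k * (sigma h)^-1)%g.
have fK : cancel f (fun h => sigma (h^-1 * k)%g).
  by move=> h; rewrite /f invMg invgK mulgKV sigmaK.
rewrite [RHS](reindex_inj (can_inj fK)) /=.
apply: eq_big => [h | h Hh]; last by rewrite antimorphJ // sigma_x -conjgM.
apply/idP/idP => [Hh | Hfh]; first by rewrite groupM ?groupV ?sigmaH.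
by rewrite -[h]fK sigmaH // groupM ?groupV.
Qed.

Lemma commuting_self_adjoint M :
  {in H, forall h, comm_mx M (rG h)} -> self_adjoint B M.
Proof.
move=> cM; have /mx_abs_irrP[_ [a aE]] := group_closure_closed_field irrG.
rewrite -[M]scale1r -(mulVf nzH) -scalerA -(conj_sum_comm sHG cM).
rewrite {}[M in conj_sum _ _ M](aE M) conj_sum_linear_combination //.
apply/self_adjointZ/self_adjoint_sum => x Gx.
exact/self_adjointZ/conj_repr_sum_self_adjoint.
Qed.

(* The projection [Q *m P] onto an irreducible [H]-summand is self-adjoint, so
   [P *m B = P *m (Q *m P) *m B = (P *m B *m P^T) *m Q^T]: the form is nonzero
   on the summand. *)
Lemma skew_contravariant_form_eq0 :
  contravariant_forms_symmetric F sigma H -> B^T = - B -> B = 0.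
Proof.
move=> symH skewB; apply/eqP/idPn => nzB.
have freeB := contravariant_form_row_free irrG formB nzB.
have [n_gt0 _] := (mx_irrP _).1 irrG.
have [k [rU [P [Q [irrU PQ PJ QJ]]]]] :=
  irreducible_direct_summand (subg_repr rG sHG) nzH n_gt0.
have symPBP : (P *m B *m P^T)^T = P *m B *m P^T.
  apply: symH irrU _.
  exact: (contravariant_form_compression (rG := rG) sHG sigmaH).
have PBP0 : P *m B *m P^T = 0.
  move: symPBP; rewrite !trmx_mul trmxK skewB mulNmx mulmxN mulmxA.
  move/eqP; rewrite eq_sym -addr_eq0 -mulr2n -scaler_nat scaler_eq0.
  by rewrite (negPf nz2) => /eqP.
have adjQP : self_adjoint B (Q *m P).
  apply: commuting_self_adjoint => h Hh.
  by rewrite /comm_mx -mulmxA PJ // !mulmxA QJ.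
have PB0 : P *m B = 0.
  rewrite -[P]mul1mx -PQ -(mulmxA P) -mulmxA adjQP.
  by rewrite trmx_mul !mulmxA PBP0 mul0mx.
have P0 : P = 0 by apply/(row_free_inj freeB); rewrite PB0 mul0mx.
have [k_gt0 _] := (mx_irrP _).1 irrU.
by move/eqP: PQ; rewrite P0 mul0mx eq_sym -mxrank_eq0 mxrank1 eqn0Ngt k_gt0.
Qed.

End Representation.

Lemma contravariant_forms_symmetric_ascent :
    contravariant_forms_symmetric F sigma H ->
  contravariant_forms_symmetric F sigma G.
Proof.
move=> symH n rG B irrG formB; apply/esym/eqP; rewrite -subr_eq0.
have formBT := contravariant_form_tr sigmaK conjugate_reversal_stable formB.
have formD := contravariant_formB formB formBT.
rewrite (skew_contravariant_form_eq0 irrG formD) //.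
by rewrite linearB /= trmxK opprB.
Qed.

End SubgroupReversal.

Definition irr_sum (gT : finGroupType) (G : {group gT}) : 'CF(G) :=
  \sum_i 'chi_i.

Section CharacterTableSum.

Variables (gT : finGroupType) (G : {group gT}).

Lemma Gamma_eE : Gamma_e G = irr_sum G 1%g.
Proof. by rewrite sum_cfunE. Qed.

Lemma char_table_sumE :
  char_table_sum G = \sum_(xG in classes G) irr_sum G (repr xG).
Proof.
rewrite /char_table_sum exchange_big reindex_irr_class /=.
by apply: eq_bigr => j _; rewrite sum_cfunE; apply: eq_bigr => i _; rewrite mxE.
Qed.

Lemma char_table_sumD1 :
  char_table_sum G
    = Gamma_e G + \sum_(xG in classes G | xG != [set 1%g]) irr_sum G (repr xG).
Proof.
by rewrite char_table_sumE (bigD1 [set 1%g]) ?classes1 //= repr_set1 Gamma_eE.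
Qed.

Lemma char_table_sum_eq_Gamma_e :
    {in G, forall g, 0 <= irr_sum G g} ->
  char_table_sum G = Gamma_e G <-> {in G^#%g, forall g, irr_sum G g = 0}.
Proof.
move=> ge0; rewrite char_table_sumD1.
have repr_in xG : xG \in classes G -> repr xG \in G.
  by case/repr_classesP.
split=> [/eqP | sum0]; last first.
  rewrite big1 ?addr0 // => xG /andP[GxG ne1].
  have [Gx defxG] := repr_classesP GxG.
  apply: sum0; rewrite !inE Gx andbT; apply: contra ne1 => /eqP x1.
  by rewrite defxG x1 class1G.
rewrite addrC -subr_eq0 addrK psumr_eq0; last first.
  by move=> xG /andP[/repr_in/ge0].
move=> /allP sum0 g /setD1P[ne1 Gg].
have := sum0 (g ^: G)%g (mem_index_enum _); rewrite mem_classes //.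
have [y Gy ->] := repr_class G g; rewrite cfunJ // => /implyP sum0g.
apply/eqP/sum0g; apply: contraNneq ne1 => /setP/(_ g).
by rewrite class_refl inE => /esym.
Qed.

Lemma Gamma_e_le_char_table_sum :
  {in G, forall g, 0 <= irr_sum G g} -> Gamma_e G <= char_table_sum G.
Proof.
move=> ge0; rewrite char_table_sumD1 lerDl sumr_ge0 // => xG /andP[GxG _].
by have [/ge0] := repr_classesP GxG.
Qed.

Lemma irr_sum_abelian : abelian G -> {in G^#%g, forall g, irr_sum G g = 0}.
Proof.
move=> abG g /setD1P[ne1 _].
have := second_orthogonality_relation g (group1 G).
rewrite class1G inE (negPf ne1) mulr0n => orth; rewrite sum_cfunE -[RHS]orth.
apply: eq_bigr => i _; rewrite lin_char1 ?rmorph1 ?mulr1 //.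
exact/char_abelianP.
Qed.

End CharacterTableSum.

Definition twisted_square (gT : finGroupType) (sigma : gT -> gT)
    (x : gT) : gT := (x * sigma x^-1)%g.

Section TwistedFrobeniusSchur.

Variables (gT : finGroupType) (sigma : gT -> gT) (G : {group gT}).
Hypothesis sigmaM : antimorphic sigma.
Hypothesis sigma_conj :
  {in G, forall g, exists2 k, k \in G & sigma g = (g ^ k)%g}.
Hypothesis symG : contravariant_forms_symmetric algC sigma G.

Let sigmaG : {in G, forall g, sigma g \in G} :=
  conjugate_reversal_stable (subxx G) sigma_conj.

Lemma mem_twisted_square x : x \in G -> twisted_square sigma x \in G.
Proof. by move=> Gx; rewrite groupM ?sigmaG ?groupV. Qed.

Lemma trmx_reversal_repr_subproof n (rG : mx_representation algC G n) :
  mx_repr G (fun x => (rG (sigma x))^T).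
Proof.
split=> [|x y Gx Gy]; first by rewrite (antimorph1 sigmaM) repr_mx1 trmx1.
by rewrite sigmaM repr_mxM ?sigmaG // trmx_mul.
Qed.

Definition trmx_reversal_repr n (rG : mx_representation algC G n) :=
  MxRepresentation (trmx_reversal_repr_subproof rG).

Lemma cfRepr_trmx_reversal n (rG : mx_representation algC G n) :
  cfRepr (trmx_reversal_repr rG) = cfRepr rG.
Proof.
apply/cfun_inP=> x Gx; rewrite !cfunE Gx /= mxtrace_tr.
have [k Gk ->] := sigma_conj Gx; rewrite conjgE !repr_mxM ?groupM ?groupV //.
by rewrite mxtrace_mulC repr_mxK.
Qed.

Lemma twisted_Frobenius_Schur_indicator (i : Iirr G) :
  \sum_(x in G) 'chi_i (twisted_square sigma x) = #|G|%:R.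
Proof.
have /irr_reprP[[n rG] /= irrG ->] := mem_irr i.
have [n_gt0 _] := (mx_irrP _).1 irrG.
have nz_n : n%:R != 0 :> algC by rewrite pnatr_eq0 -lt0n.
have /eqP/cfRepr_rsimP[B _ freeB formB] := esym (cfRepr_trmx_reversal rG).
have unitB : B \in unitmx by rewrite -row_free_unit.
have symB : B^T = B by apply: symG irrG formB.
have sigmaE x : x \in G -> rG (sigma x) = B *m (rG x)^T *m invmx B.
  move=> Gx; apply: (canRL (mulmxK unitB)); apply: trmx_inj.
  by rewrite !trmx_mul trmxK symB formB.
pose swapped x := (rG x^-1%g)^T *m invmx B *m rG x.
transitivity (\tr (B *m \sum_(x in G) swapped x)).
  rewrite mulmx_sumr linear_sum /=; apply: eq_bigr => x Gx.
  rewrite cfunE mem_twisted_square // mulr1n repr_mxM ?sigmaG ?groupV //.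
  by rewrite sigmaE ?groupV // mxtrace_mulC /swapped !mulmxA.
apply: (mulfI nz_n); rewrite -[LHS]linearZ /= scalemxAr.
have := sum_trmx_reprV_mulmx (groupC irrG) (invmx B); rewrite -/swapped => ->.
by rewrite trmx_inv symB -scalemxAr mulmxV // linearZ /= mxtrace1 mulrC.
Qed.

Lemma irr_sum_twisted_square g :
  irr_sum G g = #|'C_G[g]%g|%:R / #|G|%:R
    * #|[set x in G | g \in twisted_square sigma x ^: G]%g|%:R.
Proof.
have nzG : #|G|%:R != 0 :> algC by rewrite pnatr_eq0 -lt0n cardG_gt0.
apply: (mulIf nzG); rewrite mulrAC divfK // sum_cfunE mulr_suml.
transitivity (\sum_(x in G) \sum_i
    'chi[G]_i g * ('chi_i (twisted_square sigma x))^*).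
  rewrite exchange_big /=; apply: eq_bigr => i _.
  rewrite -mulr_sumr -rmorph_sum /=.
  by rewrite twisted_Frobenius_Schur_indicator conjC_nat.
under eq_bigr => x Gx.
  rewrite second_orthogonality_relation ?mem_twisted_square // mulrb; over.
rewrite -big_mkcondr sumr_const mulr_natr; congr (_ *+ _).
by apply: eq_card => x; rewrite inE.
Qed.

Lemma irr_sum_ge0 g : 0 <= irr_sum G g.
Proof. by rewrite irr_sum_twisted_square mulr_ge0 ?divr_ge0 ?ler0n. Qed.

Lemma irr_sum_twisted_square_neq0 x :
  x \in G -> irr_sum G (twisted_square sigma x) != 0.
Proof.
move=> Gx; rewrite irr_sum_twisted_square.
rewrite !mulf_neq0 ?invr_eq0 ?pnatr_eq0 -?lt0n ?cardG_gt0 //.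
by apply/card_gt0P; exists x; rewrite inE Gx class_refl.
Qed.

Lemma irr_sum_eq0_abelian :
  {in G^#%g, forall g, irr_sum G g = 0} <-> abelian G.
Proof.
split=> [sum0 | ]; last exact: irr_sum_abelian.
apply: (id_antimorphic_abelian sigmaM) => x Gx.
have := irr_sum_twisted_square_neq0 Gx; apply: contraNeq => ne_sx.
apply/eqP/sum0; rewrite 2!inE mem_twisted_square // andbT.
by rewrite /twisted_square antimorphV // -eq_mulgV1 eq_sym.
Qed.

End TwistedFrobeniusSchur.

Section AbelianOrbitInversion.

Variables (aT : finGroupType) (T : finType) (to : {action aT &-> T}).
Variable L : {group aT}.

Lemma orbit_representatives_through (x0 : T) :
  exists rep : T -> T,
    [/\ rep x0 = x0, {in L, forall l x, rep (to x l) = rep x}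
      & forall x, x \in orbit to L (rep x)].
Proof.
exists (fun x => if x0 \in orbit to L x then x0
                 else odflt x [pick y in orbit to L x]); split=> [|l Ll x|x].
- by rewrite orbit_refl.
- rewrite orbit_act //; case: ifP => // _.
  by case: pickP => // /(_ x); rewrite orbit_refl.
rewrite orbit_sym; case: ifP => // _.
by case: pickP => // /(_ x); rewrite orbit_refl.
Qed.

Hypothesis abL : abelian L.

Lemma abelian_act_inv x : {in L &, forall l m,
  to x l = to x m -> to x l^-1%g = to x m^-1%g}.
Proof.
move=> l m Ll Lm /(congr1 (fun y => to y (l^-1 * m^-1)%g)).
rewrite -!actM mulKVg => ->.
by rewrite (centsP abL l^-1%g) ?groupV // mulKVg.
Qed.

(* On the orbit of a representative [y], [u] is [to y l |-> to y l^-1]. *)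
Lemma abelian_orbit_inversion (x0 : T) :
  exists u : {perm T},
    [/\ u x0 = x0, {in L, forall l x, u (to x l) = to (u x) l^-1%g}
      & forall x, exists2 l, l \in L & u x = to x (l ^+ 2)%g].
Proof.
have [rep [rep0 repJ rep_orb]] := orbit_representatives_through x0.
have [coord Lcoord coordE] := fin_all_exists2 (fun x => orbitP (rep_orb x)).
pose f x := to (rep x) (coord x)^-1%g.
have fE l x : l \in L -> f (to (rep x) l) = to (rep x) l^-1%g.
  move=> Ll; have repE : rep (to (rep x) l) = rep x.
    by rewrite repJ // -[in RHS](coordE x) repJ.
  rewrite /f repE; apply: abelian_act_inv => //.
  by have := coordE (to (rep x) l); rewrite repE.
have fJ l x : l \in L -> f (to x l) = to (f x) l^-1%g.
  move=> Ll; rewrite -[in LHS](coordE x) -actM fE ?groupM // -actM -invMg.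
  by rewrite (centsP abL l).
have fK : involutive f by move=> x; rewrite [f x]/f fE ?groupV // invgK coordE.
exists (perm (inv_inj fK)); split=> [|l Ll x|x].
- by rewrite permE -{1}rep0 -(act1 to (rep x0)) fE // invg1 act1.
- by rewrite !permE fJ.
exists (coord x)^-1%g; rewrite ?groupV // permE -{2}(coordE x) -actM.
by rewrite expgS mulKVg.
Qed.

End AbelianOrbitInversion.

Lemma injective_bipartition (T : finType) (f : T -> T) :
    injective f -> (forall x, ~~ odd (fingraph.order f x)) ->
  exists eps : T -> bool, forall x, eps (f x) = ~~ eps x.
Proof.
move=> injf evenf; exists (fun x => odd (findex f (froot f x) x)) => x.
have -> : froot f (f x) = froot f x.
  apply/esym/eqP; rewrite root_connect ?fconnect1 //; exact: fconnect_sym.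
set y := froot f x; have yx : fconnect f y x.
  by rewrite fconnect_sym // connect_root.
have lt_m := findex_max yx; move: (iter_findex yx).
move: (findex f y x) lt_m => m lt_m yxE; rewrite -yxE -iterS.
move: lt_m; rewrite leq_eqVlt => /orP[/eqP mE | lt_m].
  rewrite mE iter_order // findex0; have := evenf y.
  by rewrite -mE /= => /negPn ->.
by rewrite findex_iter.
Qed.

Lemma big_bipartition (R : Type) (idx : R) (op : Monoid.com_law idx)
    (I : finType) (eps : pred I) (s t : I -> I) (F1 F2 : I -> R) :
    injective s -> injective t ->
    (forall i, eps (s i) = ~~ eps i) -> (forall i, eps (t i) = ~~ eps i) ->
    (forall i, eps i -> op (F1 i) (F1 (s i)) = op (F2 i) (F2 (t i))) ->
  \big[op/idx]_i F1 i = \big[op/idx]_i F2 i.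
Proof.
move=> injs injt epss epst eqF; rewrite (bigID eps) [RHS](bigID eps) /=.
rewrite [X in op _ X = _](reindex_inj injs) [X in _ = op _ X](reindex_inj injt).
under [X in op _ X = _]eq_bigl do rewrite epss negbK.
under [X in _ = op _ X]eq_bigl do rewrite epst negbK.
by rewrite -!big_split; apply: eq_bigr.
Qed.

Section ZpDivisibility.

Variables (r q : nat) (q_dvd : (q %| r.+1)%N).

Lemma dvdn_ZpD (x y : 'I_r.+1) : (q %| (x + y)%R)%N = (q %| x + y)%N.
Proof. by rewrite /dvdn /= modn_dvdm. Qed.

Lemma Zp_sum_modn (I : finType) (z : I -> 'I_r.+1) :
  ((\sum_i z i)%R = \sum_i (z i : nat) %[mod q])%N.
Proof.
apply: (big_ind2 (fun (x : 'I_r.+1) (y : nat) => x = y %[mod q])) => //.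
by move=> x1 x2 y1 y2 e1 e2 /=; rewrite modn_dvdm // -modnDm e1 e2 modnDm.
Qed.

End ZpDivisibility.

Section ZpParity.

Variable r : nat.
Hypothesis even_r : ~~ odd r.+1.

Lemma odd_ZpD (x y : 'I_r.+1) : odd (x + y)%R = odd x (+) odd y.
Proof. by rewrite /= odd_mod ?oddD //; apply: negbTE. Qed.

Lemma odd_Zp_sum (I : finType) (z : I -> 'I_r.+1) :
  odd (\sum_i z i)%R = \big[addb/false]_i odd (z i).
Proof.
by apply: (big_morph (fun x : 'I_r.+1 => odd x)) => // x y; apply: odd_ZpD.
Qed.

End ZpParity.

Section MonomialPermutations.

Variables r n : nat.
Local Notation perms := {perm 'I_r.+1 * 'I_n}.
Implicit Types (p g k : perms) (f : 'I_n -> 'I_r.+1) (i j a : 'I_n).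

Definition diag_fun f (x : 'I_r.+1 * 'I_n) := (x.1 + f x.2, x.2).

Lemma diag_inj f : injective (diag_fun f).
Proof.
by apply: (can_inj (g := diag_fun (fun i => - f i))) => -[b i];
   rewrite /diag_fun /= addrK.
Qed.

Definition diag f : perms := perm (@diag_inj f).

Lemma diagE f x : diag f x = (x.1 + f x.2, x.2).
Proof. by rewrite permE. Qed.

Definition scalar_rot : perms := diag (fun=> Zp1).

Lemma scalar_rotX (b : 'I_r.+1) x : (scalar_rot ^+ b)%g x = (x.1 + b, x.2).
Proof.
suff powE m : (scalar_rot ^+ m)%g x = (x.1 + Zp1 *+ m, x.2).
  by rewrite powE -FinRing.zmodXgE Zp1_expgz.
elim: m => [|m IHm].
  by rewrite expg0 perm1 mulr0n addr0 -surjective_pairing.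
by rewrite expgSr permM IHm diagE /= mulrSr addrA.
Qed.

(* The elements of G(r,1,n). In the notation (z; s) of group elements,
   [base p] is [s] and [weight p i] is [z_(s i)]. *)
Definition monomial : {group perms} := 'C[scalar_rot]%G.

Definition weight p i := (p (0, i)).1.
Definition base p i := (p (0, i)).2.
Definition color p := \sum_i weight p i.

Lemma monomialP p :
  reflect (forall b i, p (b, i) = (b + weight p i, base p i)) (p \in monomial).
Proof.
apply: (iffP cent1P) => [cp b i | pE].
  have -> : (b, i) = (scalar_rot ^+ b)%g (0, i) by rewrite scalar_rotX /= add0r.
  by rewrite -permM -(commuteX b cp) permM scalar_rotX addrC.
by apply/permP=> -[b i]; rewrite !permM pE !diagE /= pE addrAC.
Qed.

Lemma weightM p g i :
  g \in monomial -> weight (p * g)%g i = weight p i + weight g (base p i).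
Proof.
by move=> /monomialP gE; rewrite /weight permM [p _]surjective_pairing gE.
Qed.

Lemma baseM p g i : g \in monomial -> base (p * g)%g i = base g (base p i).
Proof.
by move=> /monomialP gE; rewrite /base permM [p _]surjective_pairing gE.
Qed.

Lemma weight1 i : weight 1%g i = 0.
Proof. by rewrite /weight perm1. Qed.

Lemma base1 i : base 1%g i = i.
Proof. by rewrite /base perm1. Qed.

Lemma baseK p : p \in monomial -> cancel (base p) (base p^-1%g).
Proof. by move=> mon_p i; rewrite -baseM ?groupV // mulgV base1. Qed.

Lemma base_inj p : p \in monomial -> injective (base p).
Proof. by move=> /baseK/can_inj. Qed.

Lemma baseX p m i : p \in monomial -> base (p ^+ m)%g i = iter m (base p) i.
Proof.
move=> mon_p; elim: m => [|m IHm]; first by rewrite expg0 base1.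
by rewrite expgSr baseM // IHm.
Qed.

Lemma weightV p i : p \in monomial -> weight p^-1%g (base p i) = - weight p i.
Proof.
move=> mon_p; apply/eqP; rewrite -addr_eq0 addrC -weightM ?groupV //.
by rewrite mulgV weight1.
Qed.

Lemma color1 : color 1%g = 0.
Proof. by rewrite /color big1 // => i _; apply: weight1. Qed.

Lemma colorM : {in monomial &, {morph color : p g / (p * g)%g >-> p + g}}.
Proof.
move=> p g mon_p mon_g; rewrite /color.
rewrite [X in _ + X](reindex_inj (base_inj mon_p)) -big_split.
by apply: eq_bigr => i _; rewrite weightM.
Qed.

Lemma diag_monomial f : diag f \in monomial.
Proof. by apply/monomialP=> b i; rewrite /weight /base !diagE /= add0r. Qed.

Lemma weight_diag f i : weight (diag f) i = f i.
Proof. by rewrite /weight diagE add0r. Qed.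

Lemma base_diag f i : base (diag f) i = i.
Proof. by rewrite /base diagE. Qed.

Lemma color_diag f : color (diag f) = \sum_i f i.
Proof. by apply: eq_bigr => i _; apply: weight_diag. Qed.

Lemma diag_commute f p :
  p \in monomial -> f \o base p =1 f -> commute (diag f) p.
Proof.
move=> /monomialP pE fp; apply/permP=> -[b i].
have fpi : f (base p i) = f i := fp i.
by rewrite !permM pE !diagE /= pE fpi addrAC.
Qed.

Lemma flip_inj : injective (fun x : 'I_r.+1 * 'I_n => (- x.1, x.2)).
Proof.
by apply: can_inj (fun x => (- x.1, x.2)) _ => -[b i] /=; rewrite opprK.
Qed.

Definition flip : perms := perm flip_inj.

Lemma flipE x : flip x = (- x.1, x.2).
Proof. by rewrite permE. Qed.

Lemma flipV : flip^-1%g = flip.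
Proof.
apply: (mulgI flip); rewrite mulgV; apply/permP=> -[b i].
by rewrite perm1 permM !flipE /= opprK.
Qed.

(* On monomial matrices this is transposition: inversion followed by complex
   conjugation of the entries. *)
Definition transp p : perms := (p^-1 ^ flip)%g.

Lemma transp_antimorphic : antimorphic transp.
Proof. by move=> p g; rewrite /transp invMg conjMg. Qed.

Lemma transpK : involutive transp.
Proof.
by move=> p; rewrite /transp -conjVg invgK -{2}flipV conjgK.
Qed.

Lemma transpE p x : transp p x = flip (p^-1%g (flip x)).
Proof. by rewrite /transp conjgE flipV !permM. Qed.

Lemma base_transp p i : base (transp p) i = base p^-1%g i.
Proof. by rewrite /base transpE !flipE /= oppr0. Qed.

Lemma weight_transp p i : weight (transp p) i = - weight p^-1%g i.
Proof. by rewrite /weight transpE !flipE /= oppr0. Qed.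

Lemma transp_monomial p : p \in monomial -> transp p \in monomial.
Proof.
rewrite -groupV => /monomialP pE; apply/monomialP=> b i.
by rewrite weight_transp base_transp transpE !flipE /= pE opprD opprK.
Qed.

Lemma transp_diag f : transp (diag f) = diag f.
Proof.
apply/permP=> x; rewrite transpE; apply: (canLR (permKV flip)).
rewrite flipV; apply: (canLR (permK (diag f))).
by rewrite !flipE !diagE /= opprD addrNK.
Qed.

Lemma color_transp p : p \in monomial -> color (transp p) = color p.
Proof.
move=> mon_p; rewrite /color (reindex_inj (base_inj mon_p)) /=.
by apply: eq_bigr => i _; rewrite weight_transp weightV // opprK.
Qed.

(* The powers of [base g] are even in order to preserve the classes of any
   bipartition of the indices that [base g] exchanges. *)
Definition transposer a g k : Prop :=
  [/\ k \in monomial, base k a = a,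
      forall i, exists m, base k i = iter m.*2 (base g) i
    & (g ^ k)%g = transp g].

Lemma transposer_fix a g k i :
  transposer a g k -> base g i = i -> base k i = i.
Proof. by case=> _ _ /(_ i)[m ->] _ gi; rewrite iter_fix. Qed.

(* [u] inverts the abelian group generated by [g] and [scalar_rot]; as [flip]
   also inverts [scalar_rot], the product [u * flip] is monomial. *)
Lemma exists_transposer a g : g \in monomial -> exists k, transposer a g k.
Proof.
move=> mon_g; pose L := (<[g]> <*> <[scalar_rot]>)%G.
have c_g_rot : (<[scalar_rot]> \subset 'C(<[g]>))%g.
  exact/cents_cycle/commute_sym/cent1P.
have LE : L = (<[g]> * <[scalar_rot]>)%g :> {set _} by apply: cent_joinEr.
have abL : abelian L by rewrite LE abelianM !cycle_abelian.
have [u [u0 uJ u_sq]] := abelian_orbit_inversion ('P) abL (0, a).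
have uV l : l \in L -> (l ^ u = l^-1)%g.
  move=> Ll; apply: (mulgI u); rewrite -conjgC; apply/permP=> x.
  by rewrite !permM; apply: uJ.
have Lg : g \in L by rewrite -cycle_subG joing_subl.
have Lscalar_rot : scalar_rot \in L by rewrite -cycle_subG joing_subr.
exists (u * flip)%g; split.
- rewrite -cent1C; apply/cent1P/commgP/conjg_fixP.
  by rewrite conjgM uV // -/(transp scalar_rot) transp_diag.
- by rewrite /base permM u0 flipE.
- move=> i; have [l] := u_sq (0, i).
  rewrite LE => /mulsgP[_ _ /cycleP[m ->] /cycleP[j ->] ->] uE.
  exists m; rewrite /base permM flipE /= uE -[LHS]/(base _ i).
  rewrite expgS expg1 !baseM ?groupM ?groupX ?diag_monomial //.
  rewrite !baseX ?diag_monomial // !(iter_fix _ (base_diag _ _)).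
  by rewrite -iterD addnn.
by rewrite conjgM uV.
Qed.

Lemma transposer_diagM a g k f :
    g \in monomial -> f \o base g =1 f ->
  transposer a g k -> transposer a g (diag f * k)%g.
Proof.
move=> mon_g fg [mon_k ka kX gk]; split.
- by rewrite groupM // diag_monomial.
- by rewrite baseM // base_diag.
- by move=> i; rewrite baseM // base_diag.
rewrite conjgM -[RHS]gk; congr (_ ^ _)%g.
exact/conjg_fixP/commgP/commute_sym/diag_commute.
Qed.

Lemma transposer_weight a g k i : g \in monomial -> transposer a g k ->
  weight k i + weight g (base k (base g i)) = weight g i + weight k (base g i).
Proof.
move=> mon_g [mon_k _ _ gk]; have mon_tg := transp_monomial mon_g.
have gkE : (g * k = k * transp g)%g by rewrite -gk conjgC.
have baseE : base g (base k (base g i)) = base k i.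
  rewrite -[base k _]baseM // gkE baseM // base_transp -baseM //.
  by rewrite mulVg base1.
rewrite -[RHS]weightM // gkE weightM //; congr (_ + _).
by rewrite weight_transp -baseE weightV // opprK.
Qed.

Lemma transposer_color_parity a g k (eps : pred 'I_n) :
    ~~ odd r.+1 -> g \in monomial -> transposer a g k ->
    (forall i, eps (base g i) = ~~ eps i) ->
  odd (color k) = odd (color g).
Proof.
move=> even_r mon_g trk eps_g; have [mon_k _ kX _] := trk.
have eps_k i : eps (base k i) = eps i.
  by have [m ->] := kX i; elim: m => //= m <-; rewrite !eps_g negbK.
rewrite !odd_Zp_sum //; apply: (big_bipartition (eps := eps)
    (base_inj mon_g) (inj_comp (base_inj mon_k) (base_inj mon_g))) => //= i.
  by rewrite eps_k.
move=> _; have := congr1 (fun x : 'I_r.+1 => odd x)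
  (transposer_weight i mon_g trk).
by rewrite !odd_ZpD //; do 4!case: odd.
Qed.

Lemma odd_cycle_diag g i :
    ~~ odd r.+1 -> g \in monomial -> odd (fingraph.order (base g) i) ->
  exists2 f, f \o base g =1 f & odd (color (diag f)).
Proof.
move=> even_r mon_g odd_i.
exists (fun j => inZp (fconnect (base g) i j)) => [j /=|].
  by rewrite -same_fconnect1_r //; apply: base_inj.
rewrite color_diag odd_Zp_sum //.
under eq_bigr do rewrite /= odd_mod ?(negPf even_r) // oddb.
move: odd_i; rewrite /fingraph.order -sum1_card big_mkcond /=.
rewrite (big_morph odd oddD (erefl : odd 0 = false)).
rewrite (eq_bigr (fconnect (base g) i)) // => j _.
by rewrite unfold_in; case: ifP.
Qed.

(* The parity of [color k] is corrected along an odd cycle of [g] if there is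
   one; otherwise [g] exchanges the classes of a bipartition of the indices. *)
Lemma exists_transposer_even a g :
    ~~ odd r.+1 -> g \in monomial -> ~~ odd (color g) ->
  exists2 k, transposer a g k & ~~ odd (color k).
Proof.
move=> even_r mon_g even_g; have [k trk] := exists_transposer a mon_g.
have [even_k | odd_k] := boolP (~~ odd (color k)); first by exists k.
have [/existsP[i odd_i] | no_odd] :=
    boolP [exists i, odd (fingraph.order (base g) i)].
  have [f fg odd_f] := odd_cycle_diag even_r mon_g odd_i.
  have [mon_k _ _ _] := trk.
  exists (diag f * k)%g; first exact: transposer_diagM.
  rewrite colorM ?diag_monomial // odd_ZpD // odd_f.
  by rewrite negbK in odd_k; rewrite odd_k.
have [i | eps eps_g] := injective_bipartition (base_inj mon_g).
  by apply: contra no_odd => odd_i; apply/existsP; exists i.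
by exists k => //; rewrite (transposer_color_parity even_r mon_g trk eps_g).
Qed.

Section ColorModulo.

Variable q : nat.
Hypotheses (q_dvd : (q %| r.+1)%N) (gcd_le2 : (gcdn q n <= 2)%N).

Let q_gt0 : (0 < q)%N := dvdn_gt0 (ltn0Sn r) q_dvd.

Lemma exists_transposer_gcd a g : g \in monomial -> (q %| color g)%N ->
  exists2 k, transposer a g k & (gcdn q n %| color k)%N.
Proof.
move=> mon_g qg; have [gcd2 | gcd_neq2] := eqVneq (gcdn q n) 2%N.
  have dvd2q : (2 %| q)%N by rewrite -gcd2 dvdn_gcdl.
  have [||k trk even_k] := exists_transposer_even a _ mon_g.
  - by rewrite -dvdn2 (dvdn_trans dvd2q).
  - by rewrite -dvdn2 (dvdn_trans dvd2q).
  by exists k; rewrite ?gcd2 ?dvdn2.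
have gcd1 : gcdn q n = 1%N.
  by apply/eqP; rewrite eqn_leq gcdn_gt0 q_gt0 andbT -ltnS ltn_neqAle gcd_neq2.
by have [k trk] := exists_transposer a mon_g; exists k; rewrite ?gcd1 ?dvd1n.
Qed.

Lemma dvdn_color_scalarM p : p \in monomial -> (gcdn q n %| color p)%N ->
  exists c : 'I_r.+1, (q %| color (diag (fun=> c) * p)%g)%N.
Proof.
move=> mon_p /dvdnP[w colorE]; have [b _ q_dvd_gcd] := Bezoutl n q_gt0.
exists (inZp (w * b)).
rewrite colorM ?diag_monomial // dvdn_ZpD // color_diag.
rewrite /dvdn -modnDml Zp_sum_modn // sum_nat_const card_ord /=.
rewrite -modnMmr modn_dvdm // modnMmr modnDml -/(dvdn q _) colorE.
by rewrite mulnCA -mulnDr addnC [(n * b)%N]mulnC dvdn_mull.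
Qed.

Lemma exists_transposer_dvd a g : g \in monomial -> (q %| color g)%N ->
  exists2 k, transposer a g k & (q %| color k)%N.
Proof.
move=> mon_g qg; have [k trk gcd_k] := exists_transposer_gcd a mon_g qg.
have [mon_k _ _ _] := trk; have [c qck] := dvdn_color_scalarM mon_k gcd_k.
by exists (diag (fun=> c) * k)%g => //; apply: transposer_diagM.
Qed.

End ColorModulo.

Section IndexStabilizers.

Variable q : nat.
Hypothesis q_dvd : (q %| r.+1)%N.

Lemma mem_Grqn_set p :
  (p \in Grqn_set r.+1 q n) = (p \in monomial) && (q %| color p)%N.
Proof.
rewrite inE; apply/idP/andP.
  case/existsP=> z /existsP[s /andP[sum0 /forallP pE]].
  have {}pE b i : p (b, i) = (b + z (s i), s i).
    have /andP[/eqP p1 /eqP p2] := pE (b, i).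
    by rewrite [p _]surjective_pairing p2; congr (_, _); apply: val_inj.
  have weightE i : weight p i = z (s i) by rewrite /weight pE add0r.
  split; first by apply/monomialP=> b i; rewrite weightE /base !pE.
  rewrite /dvdn Zp_sum_modn //; move: sum0.
  rewrite (reindex_inj (@perm_inj _ s)) /=.
  by under eq_bigr do rewrite -weightE.
case=> mon_p qp; pose s := perm (base_inj mon_p).
apply/existsP; exists [ffun i => weight p (s^-1%g i)].
apply/existsP; exists s; apply/andP; split.
  rewrite (reindex_inj (@perm_inj _ s)) /=.
  by under eq_bigr do rewrite ffunE permK; rewrite -Zp_sum_modn.
apply/forallP=> -[b i]; have /monomialP -> := mon_p.
by rewrite ffunE permK /= permE !eqxx.
Qed.

(* [m = 0] gives the whole group and [m >= n] its diagonal subgroup. *)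
Definition Grqn_fix_set m : {set perms} :=
  [set p in monomial | (q %| color p)%N
     & [forall i : 'I_n, (i < m)%N ==> (base p i == i)]].

Lemma Grqn_fixP m p :
  reflect [/\ p \in monomial, (q %| color p)%N
            & forall i : 'I_n, (i < m)%N -> base p i = i]
          (p \in Grqn_fix_set m).
Proof.
apply: (iffP setIdP) => [[mon_p /andP[qp /forallP fix_p]] | [mon_p qp fix_p]].
  by split=> // i lt_im; apply/eqP; apply: (implyP (fix_p i)).
split; rewrite ?qp //; apply/forallP=> i; apply/implyP=> lt_im.
by apply/eqP/fix_p.
Qed.

Lemma Grqn_fix_group_set m : group_set (Grqn_fix_set m).
Proof.
apply/group_setP; split=> [|p g].
  by apply/Grqn_fixP; split=> [||i _]; rewrite ?group1 ?color1 ?dvdn0 ?base1.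
move=> /Grqn_fixP[mon_p qp fix_p] /Grqn_fixP[mon_g qg fix_g].
apply/Grqn_fixP; split=> [||i lt_im]; first exact: groupM.
  by rewrite colorM // dvdn_ZpD // dvdn_add.
by rewrite baseM // fix_p // fix_g.
Qed.

Definition Grqn_fix m : {group perms} := Group (Grqn_fix_group_set m).

Lemma Grqn_fix0 : Grqn r.+1 q n = Grqn_fix 0.
Proof.
have setE : Grqn_set r.+1 q n = Grqn_fix_set 0.
  by apply/setP=> p; rewrite mem_Grqn_set; apply/andP/Grqn_fixP=> -[].
by apply: val_inj; rewrite /= setE gen_set_id ?Grqn_fix_group_set.
Qed.

Lemma Grqn_fixS m : Grqn_fix m.+1 \subset Grqn_fix m.
Proof.
apply/subsetP=> p /Grqn_fixP[mon_p qp fix_p].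
apply/Grqn_fixP; split=> // i lt_im.
by rewrite fix_p // ltnW.
Qed.

Lemma transp_Grqn_fix m :
  {in Grqn_fix m, forall p, transp p \in Grqn_fix m}.
Proof.
move=> p /Grqn_fixP[mon_p qp fix_p]; apply/Grqn_fixP; split=> [||i lt_im].
- exact: transp_monomial.
- by rewrite color_transp.
by rewrite base_transp -{1}(fix_p i lt_im) baseK.
Qed.

Lemma Grqn_fix_abelian m : (n <= m)%N -> abelian (Grqn_fix m).
Proof.
move=> le_nm; apply/centsP=> p /Grqn_fixP[/monomialP pE _ fix_p].
move=> g /Grqn_fixP[/monomialP gE _ fix_g]; apply/permP=> -[b i].
have lt_m (j : 'I_n) : (j < m)%N by apply: leq_trans le_nm.
by rewrite !permM !(pE, gE) !fix_p ?fix_g // addrAC.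
Qed.

Hypothesis gcd_le2 : (gcdn q n <= 2)%N.

Lemma Grqn_fix_transp_conj m : (m < n)%N ->
  {in Grqn_fix m, forall g,
    exists2 k, k \in Grqn_fix m.+1 & transp g = (g ^ k)%g}.
Proof.
move=> lt_mn g /Grqn_fixP[mon_g qg fix_g]; pose a := Ordinal lt_mn.
have [k trk qk] := exists_transposer_dvd q_dvd gcd_le2 a mon_g qg.
have [mon_k ka _ gk] := trk; exists k => //; apply/Grqn_fixP; split=> // i.
rewrite ltnS leq_eqVlt => /orP[/eqP im | /fix_g].
  by have -> : i = a by apply: ord_inj.
exact: transposer_fix trk.
Qed.

Lemma Grqn_fix_contravariant_forms_symmetric (F : closedFieldType) m :
    [pchar F] =i pred0 ->
  contravariant_forms_symmetric F transp (Grqn_fix m).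
Proof.
move=> charF0; have nz_nat d : (0 < d)%N -> d%:R != 0 :> F.
  by rewrite ((pcharf0P F).1 charF0) lt0n.
have [d] := ubnP (n - m); elim: d m => // d IHd m lt_d.
have [lt_mn | le_nm] := ltnP m n; last first.
  apply: abelian_contravariant_forms_symmetric (Grqn_fix_abelian le_nm).
  exact: group_closure_closed_field.
apply: (contravariant_forms_symmetric_ascent (H := Grqn_fix m.+1)).
- exact: transp_antimorphic.
- exact: transpK.
- exact: Grqn_fixS.
- exact: transp_Grqn_fix.
- exact: Grqn_fix_transp_conj.
- by rewrite nz_nat ?cardG_gt0.
- exact: nz_nat.
by apply: IHd; rewrite subnS prednK ?subn_gt0.
Qed.

End IndexStabilizers.

End MonomialPermutations.

Theorem theorem6p9 (r q n : nat) (hr : (0 < r)%N) (hq : (0 < q)%N) (hn : (0 < n)%N)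
    (hqr : (q %| r)%N) (hgcd : (gcdn q n <= 2)%N) :
  Gamma_e (Grqn r q n) <= char_table_sum (Grqn r q n) /\
  (char_table_sum (Grqn r q n) = Gamma_e (Grqn r q n) <-> abelian (Grqn r q n)).
Proof.
case: r hr hqr => // r _ q_dvd; rewrite (Grqn_fix0 n q_dvd).
set G := Grqn_fix n q_dvd 0.
have transpM := @transp_antimorphic r n.
have transpJ : {in G, forall g, exists2 k, k \in G & transp g = (g ^ k)%g}.
  move=> g /(Grqn_fix_transp_conj hgcd hn)[k Hk ->]; exists k => //.
  exact: (subsetP (Grqn_fixS n q_dvd 0)).
have symG : contravariant_forms_symmetric algC (@transp r n) G.
  exact/Grqn_fix_contravariant_forms_symmetric/pchar_num.
have ge0 : {in G, forall g, 0 <= irr_sum G g}.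
  by move=> g _; apply: irr_sum_ge0 transpM transpJ symG g.
split; first exact: Gamma_e_le_char_table_sum.
apply: (iff_trans (char_table_sum_eq_Gamma_e ge0)).
exact: irr_sum_eq0_abelian transpM transpJ symG.
Qed.
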